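(* Let $\theta_u,\theta_v\in\mathbb{R}$ and let $\sigma:\mathbb{P}^2_{\mathbb{C}}\to\mathbb{P}^2_{\mathbb{C}}$ be given by $[u:v:w]\mapsto[e^{i\theta_u}u:e^{i\theta_v}v:w]$. Let $\widetilde{\alpha}:\mathbb{P}^2_{\mathbb{C}}\to\mathbb{R}\times\mathbb{C}=\mathbb{R}^3$ be the map $\widetilde{\alpha}([u:v:w])=\left(\frac{|u|^2}{|u|^2+|v|^2+|w|^2},\frac{\overline{u}v}{|u|^2+|v|^2+|w|^2}\right)$. If $\widetilde{\alpha}([u:v:w])=(x,y,z)$, then $$\widetilde{\alpha}\left(\sigma([u:v:w])\right)=\begin{pmatrix} 1 & 0 & 0 \\ 0 & \cos(\theta_v-\theta_u) & -\sin(\theta_v-\theta_u) \\ 0 & \sin(\theta_v-\theta_u) & \cos(\theta_v-\theta_u) \end{pmatrix} \begin{pmatrix} x \\ y \\ z \end{pmatrix}.$$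
   Context: $\mathbb{R}^3$ is identified with $\mathbb{R}\times\mathbb{C}$ by $(x,y,z)\mapsto(x,y+iz)$. *)

(* Defs.v *)
From HB Require Import structures.
From mathcomp Require Import all_boot all_order all_algebra generic_quotient.
From mathcomp Require Import boolp reals trigo.
From mathcomp Require Import complex ring.

Set Implicit Arguments.
Unset Strict Implicit.
Unset Printing Implicit Defensive.

Import Order.TTheory GRing.Theory Num.Theory.
Local Open Scope ring_scope.
Local Open Scope complex_scope.
Local Open Scope quotient_scope.

Section ProjectivePlane.
Variable K : fieldType.

Definition row3 (u v w : K) : 'rV[K]_3 := \row_(j < 3) [:: u; v; w]`_j.

Lemma row3_eq0 (u v w : K) :
  (row3 u v w == 0) = [&& u == 0, v == 0 & w == 0].
Proof.
apply/eqP/and3P => [e|[/eqP-> /eqP-> /eqP->]].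
  have E j := congr1 (fun M : 'rV[K]_3 => M 0 j) e.
  move: (E 0) (E 1) (E 2%:R); rewrite !mxE /= => -> -> ->.
  by split.
by apply/rowP => j; rewrite !mxE; case: j => [[|[|[|//]]]].
Qed.

Definition homog_coord := {p : 'rV[K]_3 | p != 0}.

Definition proportional (p q : homog_coord) : bool :=
  `[< exists2 c : K, c != 0 & val q = c *: val p >].

Lemma proportional_refl : reflexive proportional.
Proof. by move=> p; apply/asboolP; exists 1; rewrite ?oner_neq0 ?scale1r. Qed.

Lemma proportional_sym : symmetric proportional.
Proof.
have sub p q : proportional p q -> proportional q p.
  move=> /asboolP[c c0 e]; apply/asboolP; exists c^-1; first by rewrite invr_eq0.
  by rewrite e scalerA mulVf // scale1r.
by move=> p q; apply/idP/idP; apply: sub.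
Qed.

Lemma proportional_trans : transitive proportional.
Proof.
move=> q p r /asboolP[c c0 e] /asboolP[d d0 f]; apply/asboolP.
by exists (d * c); rewrite ?mulf_neq0 // f e scalerA.
Qed.

Canonical proportional_equiv :=
  EquivRel proportional proportional_refl proportional_sym proportional_trans.

(* The projective plane K^3 \ {0} / K^*. *)
Definition P2 := {eq_quot proportional}.

(* [u : v : w] *)
Definition homog (u v w : K) (h : row3 u v w != 0) : P2 :=
  \pi_P2 (exist _ (row3 u v w) h : homog_coord).

Lemma homog_repr (p : P2) u v w (h : row3 u v w != 0) :
  p = homog h ->
  exists2 c : K, c != 0 & val (repr p) = row3 (c * u) (c * v) (c * w).
Proof.
move=> e; have : repr p = exist _ (row3 u v w) h %[mod P2] by rewrite reprK.
move=> /esym/eqquotP/asboolP[c c0 ->]; exists c => //; apply/rowP => j.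
by rewrite !mxE /=; case: j => [[|[|[|//]]]] jlt.
Qed.

End ProjectivePlane.

Arguments homog {K} u v w h.

Section Alpha.
Variable R : realType.
Local Notation C := R[i].
Local Notation normc := Normc.normc.

(* e^{it} *)
Definition expi (t : R) : C := cos t +i* sin t.

Lemma expi_neq0 t : expi t != 0.
Proof.
apply/eqP => -[c s]; have := cos2Dsin2 t.
by rewrite c s expr0n /= addr0 => /esym/eqP; rewrite oner_eq0.
Qed.

Definition sigma_coord (tu tv : R) (p : 'rV[C]_3) : 'rV[C]_3 :=
  row3 (expi tu * p 0 0) (expi tv * p 0 1) (p 0 2%:R).

Lemma sigma_coord_neq0 tu tv (p : homog_coord C) :
  sigma_coord tu tv (val p) != 0.
Proof.
apply: contra (valP p); rewrite row3_eq0 !mulf_eq0.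
rewrite !(negPf (expi_neq0 _)) /= => /and3P[/eqP a /eqP b /eqP c].
apply/eqP/rowP => j; rewrite mxE.
case: j => [[|[|[|//]]]] jlt; [rewrite -a|rewrite -b|rewrite -c];
  by congr (_ _ _); apply: val_inj.
Qed.

(* sigma and alpha act on the representative chosen by repr; sigmaE and alphaE
   give their values on arbitrary homogeneous coordinates. *)
Definition sigma (tu tv : R) (p : P2 C) : P2 C :=
  \pi_(P2 C) (exist _ (sigma_coord tu tv (val (repr p)))
                      (sigma_coord_neq0 tu tv (repr p)) : homog_coord C).

Definition alpha_coord (p : 'rV[C]_3) : R * C :=
  let u := p 0 0 in let v := p 0 1 in let w := p 0 2%:R in
  let n := normc u ^+ 2 + normc v ^+ 2 + normc w ^+ 2 in
  (normc u ^+ 2 / n, u^* * v / n%:C).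

Definition alpha (p : P2 C) : R * C := alpha_coord (val (repr p)).

Lemma sigmaE tu tv u v w (h : row3 u v w != 0)
    (h' : row3 (expi tu * u) (expi tv * v) w != 0) :
  sigma tu tv (homog u v w h) = homog (expi tu * u) (expi tv * v) w h'.
Proof.
have [c c0 e] := homog_repr (erefl (homog u v w h)).
apply/esym/eqquotP/asboolP; exists c => //=.
rewrite /sigma_coord e; apply/rowP => j; rewrite !mxE /=.
by case: j => [[|[|[|//]]]] jlt /=; rewrite // mulrCA.
Qed.

Lemma alphaE u v w (h : row3 u v w != 0) :
  alpha (homog u v w h) =
  (normc u ^+ 2 / (normc u ^+ 2 + normc v ^+ 2 + normc w ^+ 2),
   u^* * v / (normc u ^+ 2 + normc v ^+ 2 + normc w ^+ 2)%:C).
Proof.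
have [c c0 e] := homog_repr (erefl (homog u v w h)).
rewrite /alpha /alpha_coord e !mxE /= !Normc.normcM !exprMn -!mulrDr.
have nc0 : normc c ^+ 2 != 0.
  by rewrite expf_neq0 //; apply: contra c0 => /eqP/Normc.eq0_normc ->.
have cc : c^* * c = (normc c ^+ 2)%:C.
  case: (c) => a b; rewrite /= sqr_sqrtr ?addr_ge0 ?sqr_ge0 //.
  by apply/eqP; rewrite eq_complex /=; apply/andP; split; apply/eqP; ring.
congr (_, _); first by rewrite -[LHS]mulf_div divff // mul1r.
rewrite rmorphM mulrACA cc.
rewrite [X in _ / X](rmorphM (real_complex R)) -[LHS]mulf_div divff ?mul1r //.
by rewrite (fmorph_eq0 (real_complex R)).
Qed.

Definition col3 (x y z : R) : 'cV[R]_3 := \col_(i < 3) [:: x; y; z]`_i.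

(* (x, y, z) |-> (x, y + iz) *)
Definition R3_RC (p : 'cV[R]_3) : R * C := (p 0 0, p 1 0 +i* p 2%:R 0).

Lemma R3_RC_bij : bijective R3_RC.
Proof.
exists (fun q => col3 q.1 (complex.Re q.2) (complex.Im q.2)).
  move=> p; apply/colP => i; rewrite !mxE /=.
  by case: i => [[|[|[|//]]]] ilt /=; congr (_ _ _); apply: val_inj.
by case=> x [y z]; rewrite /R3_RC !mxE.
Qed.

Definition rotation_x (t : R) : 'M[R]_3 :=
  \matrix_(i < 3, j < 3)
    (nth [::] [:: [:: 1;     0;       0];
                  [:: 0; cos t; - sin t];
                  [:: 0; sin t;   cos t]] i)`_j.

End Alpha.

(* Main.v *)
(* Multiplying u and v by unit complex numbers preserves all three moduli and
   multiplies conj(u) v by e^{i (theta_v - theta_u)}; in R x C that is the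
   rotation about the x-axis. *)
Require Import Defs.
From mathcomp Require Import all_boot all_order all_algebra.
From mathcomp Require Import boolp reals trigo.
From mathcomp Require Import complex.
From mathcomp Require Import ring.

Import GRing.Theory.

Local Open Scope ring_scope.

(** On homogeneous coordinates [sigmaE] and [alphaE] make everything explicit. By [normc_expi] the
    first coordinate and the common denominator do not change; by [conjc_expiM] the complex
    coordinate gains one phase. [R3_RC_rotation_x] identifies that phase with the matrix. *)

Lemma normc_expi (R : realType) (t : R) : Normc.normc (expi t) = 1.
Proof. by rewrite /= cos2Dsin2 Num.Theory.sqrtr1. Qed.

(** These are the subtraction formulas for cosine and sine, read as real and imaginary parts. *)
Lemma conjc_expiM (R : realType) (s t : R) :
  (expi s)^* * expi t = expi (t - s).
Proof.
rewrite /expi cosB sinB; apply/eqP; rewrite eq_complex /=.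
by apply/andP; split; apply/eqP; ring.
Qed.

Lemma row3_expi_neq0 (R : realType) (s t : R) (u v w : R[i]) :
  row3 u v w != 0 -> row3 (expi s * u) (expi t * v) w != 0.
Proof. by rewrite !row3_eq0 !mulf_eq0 !(negPf (expi_neq0 _)). Qed.

Lemma R3_RC_rotation_x (R : realType) (t : R) (p : 'cV[R]_3) :
  R3_RC (rotation_x t *m p) = ((R3_RC p).1, expi t * (R3_RC p).2).
Proof.
have E (i : 'I_3) : (rotation_x t *m p) i 0 =
    rotation_x t i 0 * p 0 0 + rotation_x t i 1 * p 1 0
    + rotation_x t i 2%:R * p 2%:R 0.
  rewrite mxE !big_ord_recl big_ord0 addr0 addrA.
  (* The expanded sum is indexed by iterated lifts, which match the numerals [1] and [2%:R] only
     through their values. *)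
  by congr (_ * p _ _ + _ * p _ _ + _ * p _ _);
    rewrite ?mxE //=; apply: val_inj.
rewrite /R3_RC !E !mxE /=; congr (_, _); first by ring.
by apply/eqP; rewrite eq_complex /=; apply/andP; split; apply/eqP; ring.
Qed.

Theorem theorem3p13 (R : realType) (theta_u theta_v : R)
    (u v w : R[i]) (h : row3 u v w != 0) (x y z : R) :
  alpha (homog u v w h) = R3_RC (col3 x y z) ->
  alpha (sigma theta_u theta_v (homog u v w h)) =
  R3_RC (rotation_x (theta_v - theta_u) *m col3 x y z).
Proof.
(* With the matrix gone, the hypothesis eliminates [x], [y], [z], leaving an identity in [u], [v],
   [w]. *)
rewrite R3_RC_rotation_x => <-.
rewrite (sigmaE h (row3_expi_neq0 _ theta_u theta_v _ _ _ h)) !alphaE.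
rewrite !Normc.normcM !normc_expi !mul1r /=; congr (_, _).
by rewrite rmorphM mulrACA conjc_expiM -[LHS]mulrA.
Qed.
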